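(* Let $B=B_0+B_1$ be a unital alternative non-associative superalgebra and let $Z=Z(B)_0$ be the even part of its center. Assume that the nonzero elements of $Z$ are not zero divisors of $B$, so that $B$ is contained in the localization $Z^{-1}B$, a superalgebra over the field $k=Z^{-1}Z$. If $Z^{-1}B$ is a finite dimensional central simple superalgebra over $k$, then at least one of the following holds: (i) $B$ embeds, as a $Z$-submodule, into a free finitely generated $Z$-module; (ii) $Z^{-1}B$ is isomorphic to a superalgebra of the form $B(\Gamma,\partial,\gamma)$.
   Context: A superalgebra is a $\mathbb{Z}_2$-graded algebra $B=B_0\oplus B_1$. It is alternative if it is an alternative superalgebra in the standard sense, i.e. its Grassmann envelope is an alternative algebra. Write $(x,y,z)=(xy)z-x(yz)$ and $[x,y]=xy-yx$. The center is $Z(B)=\{x\in B\mid (x,a,b)=(a,x,b)=(a,b,x)=[a,x]=0 \ \forall a,b\in B\}$, and $Z(B)_0$ is its even part. A superalgebra $A$ over a field $k$ is central if $Z(A)_0\cong k$. It is simple if its product is nonzero and it has no graded ideals other than $0$ and $A$. $B(\Gamma,\partial,\gamma)$ is defined over a field of characteristic $3$. Let $\Gamma$ be an associative commutative algebra, $\partial$ a derivation of $\Gamma$ such that $\Gamma$ has no nonzero proper $\partial$-invariant ideals, and $\gamma\in\Gamma$. Let $\overline{\Gamma}=\{\overline{x}\mid x\in\Gamma\}$ be a copy of the vector space $\Gamma$. Then $B(\Gamma,\partial,\gamma)=\Gamma\oplus\overline{\Gamma}$ has even part $\Gamma$ and odd part $\overline{\Gamma}$, with multiplication $x\cdot y=xy$,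 $x\cdot\overline{y}=\overline{x}\cdot y=\overline{xy}$, and $\overline{x}\cdot\overline{y}=\gamma xy+2\partial(x)y+x\partial(y)$ for $x,y\in\Gamma$. *)

(* Defs.v *)
From HB Require Import structures.
From mathcomp Require Import all_boot all_order all_algebra.
Set Implicit Arguments. Unset Strict Implicit. Unset Printing Implicit Defensive.
Import Order.TTheory GRing.Theory Num.Theory.
Local Open Scope ring_scope.

Section Super.
Variables (R : pzRingType) (V : lmodType R) (mul : V -> V -> V).

Definition bilinear_mul : Prop :=
  (forall x y z, mul (x + y) z = mul x z + mul y z) /\
  (forall x y z, mul x (y + z) = mul x y + mul x z) /\
  (forall (a : R) x y, mul (a *: x) y = a *: mul x y) /\
  (forall (a : R) x y, mul x (a *: y) = a *: mul x y).

Definition subspace (P : pred V) : Prop :=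
  P 0 /\ (forall x y, P x -> P y -> P (x + y)) /\
  (forall (a : R) x, P x -> P (a *: x)).

Definition is_superalgebra (V0 V1 : pred V) : Prop :=
  bilinear_mul /\ subspace V0 /\ subspace V1 /\
  (forall x, exists x0 x1, V0 x0 /\ V1 x1 /\ x = x0 + x1) /\
  (forall x, V0 x -> V1 x -> x = 0) /\
  (forall x y, V0 x -> V0 y -> V0 (mul x y)) /\
  (forall x y, V0 x -> V1 y -> V1 (mul x y)) /\
  (forall x y, V1 x -> V0 y -> V1 (mul x y)) /\
  (forall x y, V1 x -> V1 y -> V0 (mul x y)).

Definition assoc (x y z : V) : V := mul (mul x y) z - mul x (mul y z).
Definition commut (x y : V) : V := mul x y - mul y x.

Definition of_parity (V0 V1 : pred V) (p : bool) (x : V) : bool :=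
  if p then V1 x else V0 x.

(* Alternative superalgebra: its Grassmann envelope is alternative.
   Spelled out on homogeneous elements (this is exactly what alternativity
   of the Grassmann envelope G0 (x) V0 + G1 (x) V1 unfolds to):
     (x,y,z) + (-1)^{|x||y|} (y,x,z) = 0,
     (x,y,z) + (-1)^{|y||z|} (x,z,y) = 0,
   and (x,x,y) = (y,x,x) = 0 for even x. *)
Definition super_alternative (V0 V1 : pred V) : Prop :=
  (forall (p q r : bool) x y z,
      of_parity V0 V1 p x -> of_parity V0 V1 q y -> of_parity V0 V1 r z ->
      assoc x y z + ((-1) ^+ (p && q)) *: assoc y x z = 0 /\
      assoc x y z + ((-1) ^+ (q && r)) *: assoc x z y = 0) /\
  (forall x y, V0 x -> assoc x x y = 0 /\ assoc y x x = 0).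

Definition in_center (x : V) : Prop :=
  forall a b, assoc x a b = 0 /\ assoc a x b = 0 /\ assoc a b x = 0 /\
              commut a x = 0.

Definition in_even_center (V0 : pred V) (x : V) : Prop := in_center x /\ V0 x.

Definition is_unit_elt (e : V) : Prop := forall x, mul e x = x /\ mul x e = x.

Definition graded_ideal (V0 V1 : pred V) (I : pred V) : Prop :=
  subspace I /\ (forall a x, I x -> I (mul a x) /\ I (mul x a)) /\
  (forall x x0 x1, I x -> V0 x0 -> V1 x1 -> x = x0 + x1 -> I x0 /\ I x1).

Definition simple_super (V0 V1 : pred V) : Prop :=
  (exists x y, mul x y <> 0) /\
  (forall I, graded_ideal V0 V1 I -> (forall x, I x -> x = 0) \/ (forall x, I x)).

End Super.

Definition finite_dim (R : pzRingType) (V : lmodType R) : Prop :=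
  exists s : seq V, forall x : V,
    exists c : 'I_(size s) -> R, x = \sum_(i < size s) c i *: s`_i.

Definition central_super (k : fieldType) (A : lmodType k) (mulA : A -> A -> A)
  (A0 : pred A) (oneA : A) : Prop :=
  forall x, in_even_center mulA A0 x <-> exists c : k, x = c *: oneA.

(* Localization Z^{-1}B, Z = Z(B)_0, characterized up to isomorphism:  *)
(* A is a superalgebra over the field k; iota : B -> A and             *)
(* kappa : Z -> k (given as a map on B, only used on Z) with           *)
(*  - iota an injective, additive, multiplicative, grading-preserving  *)
(*    map,                                                             *)
(*  - kappa an injective ring map Z -> k with k = {kappa z1/kappa z2}, *)
(*    i.e. k = Z^{-1}Z,                                                *)
(*  - iota z = kappa z . 1 for z in Z, and                             *)
(*  - every element of A is (kappa z)^{-1} . iota b, z in Z \ 0.       *)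
Definition is_localization (F : fieldType) (B : lmodType F) (mulB : B -> B -> B)
  (B0 B1 : pred B) (oneB : B)
  (k : fieldType) (A : lmodType k) (mulA : A -> A -> A) (A0 A1 : pred A)
  (iota : B -> A) (kappa : B -> k) : Prop :=
  let Z := in_even_center mulB B0 in
  is_superalgebra mulA A0 A1 /\
  (forall x y, iota (x + y) = iota x + iota y) /\
  (forall x y, iota (mulB x y) = mulA (iota x) (iota y)) /\
  injective iota /\
  (forall x, B0 x -> A0 (iota x)) /\ (forall x, B1 x -> A1 (iota x)) /\
  (forall z z', Z z -> Z z' ->
     kappa (z + z') = kappa z + kappa z' /\ kappa (mulB z z') = kappa z * kappa z') /\
  (forall z, Z z -> kappa z = 0 -> z = 0) /\
  (forall z, Z z -> iota z = kappa z *: iota oneB) /\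
  (forall c : k, exists z1 z2, Z z1 /\ Z z2 /\ z2 <> 0 /\ c = kappa z1 / kappa z2) /\
  (forall a : A, exists b z, Z z /\ z <> 0 /\ a = (kappa z)^-1 *: iota b).

Definition embeds_in_free_fg_module (F : fieldType) (B : lmodType F)
  (mulB : B -> B -> B) (Z : B -> Prop) : Prop :=
  exists (n : nat) (f : 'I_n -> B -> B),
    (forall i b, Z (f i b)) /\
    (forall i x y, f i (x + y) = f i x + f i y) /\
    (forall i z b, Z z -> f i (mulB z b) = mulB z (f i b)) /\
    (forall b, (forall i, f i b = 0) -> b = 0).

(* The superalgebra B(Gamma, d, gamma) over k (char 3), realised on    *)
(* Gamma * Gamma: (x, x') stands for x + bar x'.                        *)
Section BGamma.
Variables (k : fieldType) (G : comAlgType k).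

Definition BG_mul (d : G -> G) (g : G) (u v : G * G) : G * G :=
  (u.1 * v.1 + (g * u.2 * v.2 + (d u.2 * v.2) *+ 2 + u.2 * d v.2),
   u.1 * v.2 + u.2 * v.1).

Definition is_derivation (d : G -> G) : Prop :=
  (forall (a : k) x y, d (a *: x + y) = a *: d x + d y) /\
  (forall x y, d (x * y) = d x * y + x * d y).

Definition ideal_of (I : pred G) : Prop :=
  I 0 /\ (forall x y, I x -> I y -> I (x + y)) /\
  (forall (a : k) x, I x -> I (a *: x)) /\ (forall a x, I x -> I (a * x)).

Definition d_simple (d : G -> G) : Prop :=
  forall I, ideal_of I -> (forall x, I x -> I (d x)) ->
    (forall x, I x -> x = 0) \/ (forall x, I x).

Definition iso_to_BG (A : lmodType k) (mulA : A -> A -> A) (A0 A1 : pred A)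
  (d : G -> G) (g : G) : Prop :=
  exists phi : A -> G * G,
    bijective phi /\
    (forall (c : k) x y, (phi (c *: x + y)).1 = c *: (phi x).1 + (phi y).1 /\
                         (phi (c *: x + y)).2 = c *: (phi x).2 + (phi y).2) /\
    (forall x y, phi (mulA x y) = BG_mul d g (phi x) (phi y)) /\
    (forall x, A0 x -> (phi x).2 = 0) /\ (forall x, A1 x -> (phi x).1 = 0).

End BGamma.

(* Main.v *)
Require Import Defs.
From HB Require Import structures.
From mathcomp Require Import all_boot all_order all_algebra.
From mathcomp Require Import boolp.
Set Implicit Arguments. Unset Strict Implicit. Unset Printing Implicit Defensive.
Import Order.TTheory GRing.Theory Num.Theory.
Local Open Scope ring_scope.

(** The algebra of operators on A := Z^-1 B generated by the left and right
    multiplications and the projection onto the even part acts irreducibly,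
    because A is simple, and its commutant consists of the multiplications by
    elements of the even center k.  By Jacobson density it contains, for every
    basis of A, the operators x |-> x_i 1 sending x to its i-th coordinate.
    Such an operator involves finitely many elements of A, so a multiple of it
    by some nonzero z in Z maps B to B, hence to the intersection of B with
    k 1, which is Z.  The resulting maps B -> Z are the coordinates of an
    embedding into a free module, so the first alternative always holds. *)

(** * Linear maps given as plain functions *)

Section LinearMap.
Variables (R : pzRingType) (V W : lmodType R) (T : V -> W).
Hypothesis linT : linear T.

Lemma linear_map0 : T 0 = 0.
Proof. by have := linT (-1) 0 0; rewrite scaler0 addr0 scaleN1r addNr. Qed.

Lemma linear_mapD x y : T (x + y) = T x + T y.
Proof. by have := linT 1 x y; rewrite !scale1r. Qed.

Lemma linear_mapZ a x : T (a *: x) = a *: T x.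
Proof. by have := linT a x 0; rewrite linear_map0 !addr0. Qed.

Lemma linear_map_sum n (c : 'I_n -> R) (e : 'I_n -> V) :
  T (\sum_i c i *: e i) = \sum_i c i *: T (e i).
Proof.
elim: n c e => [|n IHn] c e; first by rewrite !big_ord0 linear_map0.
by rewrite !big_ord_recl linear_mapD linear_mapZ IHn.
Qed.

End LinearMap.

(** * The projection onto the even part *)

Section GradedProjection.
Variables (R : pzRingType) (V : lmodType R) (mul : V -> V -> V) (V0 V1 : pred V).
Hypothesis superV : is_superalgebra mul V0 V1.

Lemma graded_decomp_unique x0 x1 y0 y1 :
  V0 x0 -> V0 y0 -> V1 x1 -> V1 y1 -> x0 + x1 = y0 + y1 -> x0 = y0.
Proof.
case: superV => _ [[_ [add0 scal0]] [[_ [add1 scal1]] [_ [cap0 _]]]].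
move=> Vx0 Vy0 Vx1 Vy1 eq_xy; apply/eqP; rewrite -subr_eq0; apply/eqP/cap0.
  by rewrite -scaleN1r; apply: add0 => //; apply: scal0.
have ->: x0 - y0 = y1 - x1.
  by apply/eqP; rewrite subr_eq addrAC eq_sym subr_eq addrC eq_xy addrC.
by rewrite -scaleN1r; apply: add1 => //; apply: scal1.
Qed.

Lemma even_projection : exists p : V -> V,
  [/\ linear p, forall x, V0 (p x)
    & forall x x0 x1, V0 x0 -> V1 x1 -> x = x0 + x1 -> p x = x0].
Proof.
have [_ [[_ [add0 scal0]] [[_ [add1 scal1]] [decomp _]]]] := superV.
(* Writing the odd component as [x - x0] leaves a boolean condition on [x0] alone, to which
   [xchoose] applies. *)
have exP x : exists x0, V0 x0 && V1 (x - x0).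
  have [x0 [x1 [Vx0 [Vx1 ->]]]] := decomp x; exists x0.
  by rewrite addrC addKr Vx0 Vx1.
have pP x : V0 (xchoose (exP x)) /\ V1 (x - xchoose (exP x)).
  by apply/andP; exact: xchooseP (exP x).
have pE x x0 x1 : V0 x0 -> V1 x1 -> x = x0 + x1 -> xchoose (exP x) = x0.
  move=> Vx0 Vx1 def_x; have [Vp Vq] := pP x.
  by apply: graded_decomp_unique Vp Vx0 Vq Vx1 _; rewrite addrC subrK.
exists (fun x => xchoose (exP x)); split=> //= [a x y|x]; last by case: (pP x).
have [[Vx Wx] [Vy Wy]] := (pP x, pP y).
apply: (pE _ _ (a *: (x - xchoose (exP x)) + (y - xchoose (exP y)))).
- by apply: add0 => //; apply: scal0.
- by apply: add1 => //; apply: scal1.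
by rewrite addrACA -scalerDr !subrKC.
Qed.

End GradedProjection.

(** * Jacobson density for a central simple superalgebra *)

Section Density.
Variables (k : fieldType) (A : lmodType k) (mul : A -> A -> A).
Variables (A0 A1 : pred A) (one : A) (p : A -> A).
Hypothesis superA : is_superalgebra mul A0 A1.
Hypothesis one_unit : is_unit_elt mul one.
Hypothesis even_p : forall x, A0 (p x).
Hypothesis pE : forall x x0 x1, A0 x0 -> A1 x1 -> x = x0 + x1 -> p x = x0.
Hypothesis central : central_super mul A0 one.
Hypothesis simple : simple_super mul A0 A1.

(** [M] stays abstract so that it can later be the class of operators with a common denominator on
    [B]. Density then directly yields operators in that class. *)
Variable M : (A -> A) -> Prop.
Hypothesis M_linear : forall T, M T -> linear T.
Hypothesis M_left : forall a, M (mul a).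
Hypothesis M_right : forall a, M (mul^~ a).
Hypothesis M_proj : M p.
Hypothesis M_add : forall S T, M S -> M T -> M (fun x => S x + T x).
Hypothesis M_comp : forall S T, M S -> M T -> M (S \o T).

Let mulZl a x y : mul (a *: x) y = a *: mul x y.
Proof. by case: superA => [[_ [_ []]]]. Qed.
Let mulNl x y : mul (- x) y = - mul x y.
Proof. by rewrite -scaleN1r mulZl scaleN1r. Qed.
Let mul1l x : mul one x = x. Proof. by case: (one_unit x). Qed.
Let mul1r x : mul x one = x. Proof. by case: (one_unit x). Qed.
Let mulZ1 c x : mul (c *: one) x = c *: x.
Proof. by rewrite mulZl mul1l. Qed.
Let even1 : A0 one.
Proof. by case: ((central one).2 _) => //; exists 1; rewrite scale1r. Qed.
Let p_even x : A0 x -> p x = x.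
Proof.
move=> Ax; apply: (@pE _ _ 0 Ax); last by rewrite addr0.
by case: superA => _ [_ [[]]].
Qed.

Lemma operator_id : M id.
Proof.
by have -> : id = mul one by apply: funext => x; rewrite mul1l.
Qed.

Definition left_operator_ideal (J : (A -> A) -> Prop) :=
  [/\ exists T, J T, forall T, J T -> M T,
      forall S T, J S -> J T -> J (fun x => S x + T x)
    & forall S T, M S -> J T -> J (S \o T)].

(** The orbit J y is a graded ideal: [M] contains the multiplications, among them those by scalar
    multiples of 1, and stability under [p] makes the orbit graded. Simplicity leaves only 0 and
    A. *)
Lemma left_operator_ideal_orbit J y : left_operator_ideal J ->
  (forall T, J T -> T y = 0) \/ (forall x, exists2 T, J T & T y = x).
Proof.
move=> [[T0 JT0] JM Jadd Jcomp].
pose I : pred A := fun x => `[< exists2 T, J T & T y = x >].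
have IP x : reflect (exists2 T, J T & T y = x) (I x) by apply: asboolP.
have I_op S x : M S -> I x -> I (S x).
  by move=> MS /IP[T JT <-]; apply/IP; exists (S \o T) => //; apply: Jcomp.
have I_scal a x : I x -> I (a *: x).
  by move=> Ix; rewrite -mulZ1; apply: (I_op (mul _)).
have I_add u v : I u -> I v -> I (u + v).
  move=> /IP[S JS <-] /IP[T JT <-]; apply/IP.
  by exists (fun x => S x + T x) => //; apply: Jadd.
have gradedI : graded_ideal mul A0 A1 I.
  split; [split; [|by split]|split].
  - by rewrite -(scale0r (T0 y)); apply: I_scal; apply/IP; exists T0.
  - by move=> a x Ix; split; [apply: (I_op (mul a))|apply: (I_op (mul^~ a))].
  move=> x x0 x1 Ix Ax0 Ax1 def_x.
  have Ix0 : I x0 by rewrite -(pE Ax0 Ax1 def_x); apply: I_op.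
  split=> //; have -> : x1 = x + (-1) *: x0.
    by rewrite def_x scaleN1r addrC addKr.
  by apply: I_add => //; apply: I_scal.
case: simple => _ /(_ I gradedI)[I0|IT]; [left=> T JT|right=> x].
  by apply: I0; apply/IP; exists T.
exact/IP.
Qed.

Lemma operator_transitive y x : y != 0 -> exists2 T, M T & T y = x.
Proof.
have idealM : left_operator_ideal M.
  by split=> //; exists id; apply: operator_id.
move=> y_neq0; have [M0|//] := left_operator_ideal_orbit y idealM.
by have /eqP := M0 id operator_id; rewrite (negPf y_neq0).
Qed.

Definition spanned_by n (e : 'I_n -> A) x := exists c, x = \sum_i c i *: e i.

(* If J y = A, then T y |-> T x (for T in J) commutes with M, so it is the
   multiplication by an element of the even center. *)
Lemma left_operator_ideal_scalar J x y : left_operator_ideal J ->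
    (forall T, J T -> T y = 0 -> T x = 0) ->
  exists c : k, forall T, J T -> T x = c *: T y.
Proof.
move=> idealJ Jyx; have [J0|Jtrans] := left_operator_ideal_orbit y idealJ.
  by exists 0 => T JT; rewrite scale0r; apply: Jyx => //; apply: J0.
have [_ _ Jadd Jcomp] := idealJ.
(* As [T0] sends y to 1, the element [T0 x] is the only candidate for the multiplier. *)
have [T0 JT0 T0y] := Jtrans one.
(* The map T y |-> T x is well defined; the difference S - T is formed with the left multiplication
   by -1. *)
have Jeq S T : J S -> J T -> S y = T y -> S x = T x.
  move=> JS JT eqST; apply/eqP; rewrite -subr_eq0; apply/eqP.
  have JN : J (fun u => S u + (mul (- one) \o T) u).
    by apply: Jadd => //; apply: Jcomp.
  have := Jyx _ JN; rewrite /= !mulNl !mul1l eqST; apply; exact: subrr.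
(* T and the operator u |-> (T0 u)(T y) both lie in J and agree at y, hence also at x. *)
have c_left T : J T -> T x = mul (T0 x) (T y).
  move=> JT; apply: (Jeq _ (mul^~ (T y) \o T0)) => //=; first exact: Jcomp.
  by rewrite T0y mul1l.
have c_right T : J T -> T x = mul (T y) (T0 x).
  move=> JT; apply: (Jeq _ (mul (T y) \o T0)) => //=; first exact: Jcomp.
  by rewrite T0y mul1r.
have c_comm a : mul a (T0 x) = mul (T0 x) a.
  have [T JT <-] := Jtrans a; by rewrite -c_left // -c_right.
(* Write a = T y and apply [c_left] to both T and S T. Taking multiplications for S will give the
   associator identities, and taking [p] the evenness of [T0 x]. *)
have c_mul S a : M S -> S (mul (T0 x) a) = mul (T0 x) (S a).
  move=> MS; have [T JT <-] := Jtrans a.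
  by rewrite -c_left // -[LHS]/((S \o T) x) c_left //; apply: Jcomp.
have [c cE] : exists c, T0 x = c *: one.
  apply/central; split; last first.
    rewrite -(_ : p (T0 x) = T0 x) //.
    have := c_mul p one M_proj; rewrite (p_even even1) !mul1r //.
  move=> a b; rewrite /assoc /commut.
  do ![split]; apply/eqP; rewrite subr_eq0; apply/eqP.
  - exact: (c_mul (mul^~ b)).
  - by rewrite c_comm (c_mul (mul^~ b)) // (c_mul (mul a)).
  - by rewrite !c_comm (c_mul (mul a)).
  - exact: c_comm.
by exists c => T JT; rewrite c_left // cE mulZ1.
Qed.

(** Induction on n. The operators killing every e_i but the first form a left ideal J, on which T x
    = c T e_0 for a fixed scalar c. So x - c e_0 is killed by J, and the induction hypothesis puts
    it in the span of the other e_i. *)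
Lemma operator_density n (e : 'I_n -> A) x :
  (forall T, M T -> (forall i, T (e i) = 0) -> T x = 0) -> spanned_by e x.
Proof.
elim: n e x => [|n IHn] e x annx.
  exists (fun=> 0); rewrite big_ord0.
  by apply: (annx id operator_id) => -[].
pose J T := M T /\ forall i, T (e (lift ord0 i)) = 0.
have idealJ : left_operator_ideal J.
  split=> [|T []//|S T [MS S0] [MT T0]|S T MS [MT T0]].
  - exists (mul 0); split=> // i.
    by have := mulZ1 0 (e (lift ord0 i)); rewrite !scale0r.
  - by split=> [|i]; [apply: M_add|rewrite S0 T0 addr0].
  - by split=> [|i]; [apply: M_comp|rewrite /= T0 (linear_map0 (M_linear MS))].
have [|c cP] := @left_operator_ideal_scalar J x (e ord0) idealJ.
  move=> T [MT T0] Te0; apply: annx => // i.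
  by case: (unliftP ord0 i) => [j|] ->.
have [|d dE] := IHn (e \o lift ord0) (x - c *: e ord0).
  move=> T MT T0; have linT := M_linear MT.
  rewrite -scaleN1r (linear_mapD linT) !(linear_mapZ linT).
  by rewrite (cP T) // scaleN1r subrr.
exists (fun i => if unlift ord0 i is Some j then d j else c).
rewrite big_ord_recl unlift_none; under eq_bigr do rewrite liftK.
by rewrite -dE addrC subrK.
Qed.

(** A spanning family of minimal size serves as a basis. Density gives an operator killing all its
    members but one, and transitivity moves the remaining value to 1. *)
Lemma coordinate_operators : finite_dim A ->
  exists n (T : 'I_n -> A -> A),
    [/\ forall i, M (T i), forall i x, exists c, T i x = c *: one
      & forall x, (forall i, T i x = 0) -> x = 0].
Proof.
move=> [s spans].
pose P n := `[< exists e : 'I_n -> A, forall x, spanned_by e x >].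
have exP : exists n, P n.
  by exists (size s); apply/asboolP; exists (fun i => s`_i).
case: (ex_minnP exP) => n /asboolP[e spane] min_n.
have one_neq0 : one != 0.
  apply/eqP => one0; case: simple => -[x [y]] + _; apply.
  by rewrite -(mul1l (mul x y)) one0 -(scale0r one) mulZ1 !scale0r.
have dualP i : exists T, M T /\ forall j, T (e j) = (j == i)%:R *: one.
  have [T] : exists T, [/\ M T, forall j, j != i -> T (e j) = 0 & T (e i) != 0].
    apply: contrapT => noT.
    move: e spane min_n i noT; case: n => [|n] e spane min_n i noT.
      by case: i noT.
    (* If every operator killing the other members killed e_i too, e_i would lie in their span and
       could be dropped, against minimality. *)
    have [|d dE] := @operator_density n (e \o lift i) (e i).
      move=> T MT T0; apply: contrapT => /eqP Tei; apply: noT; exists T.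
      split=> // j /eqP; case: (unliftP i j) => [l -> _|-> //]; exact: T0.
    suff /min_n : P n by rewrite ltnn.
    apply/asboolP; exists (e \o lift i) => x; have [c ->] := spane x.
    exists (fun j => c i * d j + c (lift i j)).
    rewrite (bigD1_ord i) //= dE scaler_sumr -big_split /=.
    by apply: eq_bigr => j _; rewrite scalerDl scalerA.
  move=> [MT T0 /(operator_transitive one)[S MS STei]].
  exists (S \o T); split=> [|j /=]; first exact: M_comp.
  case: eqP => [->|/eqP/T0 ->]; first by rewrite scale1r.
  by rewrite scale0r (linear_map0 (M_linear MS)).
have [T TP] := choice dualP.
have TE i (c : 'I_n -> k) : T i (\sum_j c j *: e j) = c i *: one.
  have [MT Te] := TP i; rewrite (linear_map_sum (M_linear MT)) (bigD1 i) //=.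
  rewrite Te eqxx scale1r big1 ?addr0 // => j /negPf ji.
  by rewrite Te ji scale0r scaler0.
exists n, T; split=> [i|i x|x Tx0]; first by case: (TP i).
  by have [c ->] := spane x; exists (c i); apply: TE.
have [c def_x] := spane x; rewrite def_x big1 // => i _.
have /eqP := Tx0 i; rewrite def_x TE scaler_eq0 (negPf one_neq0) orbF => /eqP->.
exact: scale0r.
Qed.

End Density.

(** * Clearing denominators in the localization *)

Section Localization.
Variables (F : fieldType) (B : lmodType F) (mulB : B -> B -> B).
Variables (B0 B1 : pred B) (oneB : B).
Variables (k : fieldType) (A : lmodType k) (mulA : A -> A -> A) (A0 A1 : pred A).
Variables (iota : B -> A) (kappa : B -> k).
Hypothesis superB : is_superalgebra mulB B0 B1.
Hypothesis unitB : is_unit_elt mulB oneB.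
Hypothesis locA :
  is_localization mulB B0 B1 oneB mulA A0 A1 iota kappa.
Hypothesis centralA : central_super mulA A0 (iota oneB).

Let superA : is_superalgebra mulA A0 A1. Proof. by case: locA. Qed.
Let iotaD x y : iota (x + y) = iota x + iota y.
Proof. by case: locA => _ []. Qed.
Let iotaM x y : iota (mulB x y) = mulA (iota x) (iota y).
Proof. by case: locA => _ [_ []]. Qed.
Let iota_inj : injective iota.
Proof. by case: locA => _ [_ [_ []]]. Qed.
Let iota0 : iota 0 = 0.
Proof. by apply: (addrI (iota 0)); rewrite -iotaD !addr0. Qed.
Let iotaB x y : iota (x - y) = iota x - iota y.
Proof. by apply: (addIr (iota y)); rewrite -iotaD !subrK. Qed.
Let iota_even x : B0 x -> A0 (iota x).
Proof. by case: locA => _ [_ [_ [_ [h _]]]]; apply: h. Qed.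
Let iota_odd x : B1 x -> A1 (iota x).
Proof. by case: locA => _ [_ [_ [_ [_ [h _]]]]]; apply: h. Qed.

Let mulDl x y z : mulA (x + y) z = mulA x z + mulA y z.
Proof. by case: superA => [[]]. Qed.
Let mulDr x y z : mulA x (y + z) = mulA x y + mulA x z.
Proof. by case: superA => [[_ []]]. Qed.
Let mulZl a x y : mulA (a *: x) y = a *: mulA x y.
Proof. by case: superA => [[_ [_ []]]]. Qed.
Let mulZr a x y : mulA x (a *: y) = a *: mulA x y.
Proof. by case: superA => [[_ [_ []]]]. Qed.

Lemma localization_fraction a :
  exists b z, [/\ in_even_center mulB B0 z, kappa z != 0 & kappa z *: a = iota b].
Proof.
case: locA => _ [_ [_ [_ [_ [_ [_ [ker [_ [_ frac]]]]]]]]].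
have [b [z [Zz [z0 ->]]]] := frac a; have kz : kappa z != 0.
  by apply/eqP => /(ker z Zz).
by exists b, z; split=> //; rewrite scalerA mulfV // scale1r.
Qed.

Lemma localization_unit : is_unit_elt mulA (iota oneB).
Proof.
move=> a; have [b [z [_ kz kza]]] := localization_fraction a.
have [mul1b mulb1] := unitB b.
split; apply: (scalerI kz); first by rewrite -mulZr kza -iotaM mul1b.
by rewrite -mulZl kza -iotaM mulb1.
Qed.

Lemma iota_central_mul z b :
  in_even_center mulB B0 z -> iota (mulB z b) = kappa z *: iota b.
Proof.
case: locA => _ [_ [_ [_ [_ [_ [_ [_ [iotaZ _]]]]]]]] Zz.
by rewrite iotaM iotaZ // mulZl; case: (localization_unit (iota b)) => ->.
Qed.

(** This is the inclusion of the intersection of B with k 1 in Z. The center identities pull back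
    along the injection [iota]; evenness follows by comparing the images of the homogeneous
    components of b with the even element [iota b]. *)
Lemma iota_scalar_central c b :
  iota b = c *: iota oneB -> in_even_center mulB B0 b.
Proof.
move=> def_b; have [cent_b even_b] : in_even_center mulA A0 (iota b).
  by apply/centralA; exists c.
split.
  move=> x y; have [h1 [h2 [h3 h4]]] := cent_b (iota x) (iota y).
  by do ![split]; apply: iota_inj; rewrite iota0 iotaB !iotaM.
have [_ [_ [[B1_0 _] [decomp _]]]] := superB.
have [b0 [b1 [Bb0 [Bb1 def_bb]]]] := decomp b.
have A1_0 : A1 0 by case: superA => _ [_ [[]]].
suff -> : b = b0 by [].
apply/iota_inj/(graded_decomp_unique superA even_b _ A1_0 (iota_odd Bb1)).
  exact: iota_even.
by rewrite addr0 def_bb iotaD.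
Qed.

(** Denominators are the nonzero scalars that preserve the image of [B]: the nonzero [kappa z] are
    among them, and closure under products is immediate. *)
Definition integral_scalar (c : k) :=
  c != 0 /\ forall b, exists b', iota b' = c *: iota b.

(** The class to be substituted for [M]. The denominator c must itself preserve the image of [B],
    because in a sum each term is also multiplied by the denominator of the other. *)
Definition almost_integral (T : A -> A) :=
  linear T /\
  exists2 c, integral_scalar c & forall b, exists b', iota b' = c *: T (iota b).

Lemma integral_scalar_kappa z :
  in_even_center mulB B0 z -> kappa z != 0 -> integral_scalar (kappa z).
Proof.
by move=> Zz kz; split=> // b; exists (mulB z b); apply: iota_central_mul.
Qed.

Lemma integral_scalarM c d :
  integral_scalar c -> integral_scalar d -> integral_scalar (c * d).
Proof.
move=> [c0 intc] [d0 intd]; split=> [|b]; first by rewrite mulf_neq0.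
have [b' b'E] := intd b; have [b'' b''E] := intc b'.
by exists b''; rewrite b''E b'E scalerA.
Qed.

Lemma almost_integral_left a : almost_integral (mulA a).
Proof.
split=> [c x y|]; first by rewrite mulDr mulZr.
have [b [z [Zz kz kza]]] := localization_fraction a.
exists (kappa z) => [|b']; first exact: integral_scalar_kappa.
by exists (mulB b b'); rewrite iotaM -kza mulZl.
Qed.

Lemma almost_integral_right a : almost_integral (mulA^~ a).
Proof.
split=> [c x y|]; first by rewrite mulDl mulZl.
have [b [z [Zz kz kza]]] := localization_fraction a.
exists (kappa z) => [|b']; first exact: integral_scalar_kappa.
by exists (mulB b' b); rewrite iotaM -kza mulZr.
Qed.

Lemma almost_integral_proj p : linear p ->
    (forall x x0 x1, A0 x0 -> A1 x1 -> x = x0 + x1 -> p x = x0) ->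
  almost_integral p.
Proof.
(* Denominator 1 suffices because [iota] respects the grading. *)
move=> linp pE; split=> //; exists 1.
  by split=> [|b]; [apply: oner_neq0|exists b; rewrite scale1r].
move=> b; have [_ [_ [_ [decomp _]]]] := superB.
have [b0 [b1 [Bb0 [Bb1 ->]]]] := decomp b; exists b0.
by rewrite scale1r (pE _ _ _ (iota_even Bb0) (iota_odd Bb1)).
Qed.

Lemma almost_integralD S T :
  almost_integral S -> almost_integral T -> almost_integral (fun x => S x + T x).
Proof.
move=> [linS [c intc intS]] [linT [d intd intT]]; split=> [a x y|].
  by rewrite linS linT scalerDr addrACA.
exists (c * d) => [|b]; first exact: integral_scalarM.
have [bS bSE] := intS b; have [bT bTE] := intT b.
have [bS' bS'E] := intd.2 bS; have [bT' bT'E] := intc.2 bT.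
exists (bS' + bT').
by rewrite iotaD bS'E bT'E bSE bTE !scalerA [d * c]mulrC -scalerDr.
Qed.

Lemma almost_integral_comp S T :
  almost_integral S -> almost_integral T -> almost_integral (S \o T).
Proof.
move=> [linS [c intc intS]] [linT [d intd intT]]; split=> [a x y|].
  by rewrite /= linT linS.
exists (c * d) => [|b]; first exact: integral_scalarM.
have [b' b'E] := intT b; have [b'' b''E] := intS b'; exists b''.
by rewrite b''E b'E (linear_mapZ linS) scalerA.
Qed.

Lemma localization_embeds : finite_dim A -> simple_super mulA A0 A1 ->
  embeds_in_free_fg_module mulB (in_even_center mulB B0).
Proof.
move=> finA simpleA; have [p [linp even_p pE]] := even_projection superA.
have [n [T [MT Tscal Tinj]]] := coordinate_operators superA localization_unit
  even_p pE centralA simpleA (fun T MT => proj1 MT) almost_integral_left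
  almost_integral_right (almost_integral_proj linp pE) almost_integralD
  almost_integral_comp finA.
(* Each c T_i preserves the image of [B], so it pulls back to a map f_i on [B]. The nonzero c may
   depend on i. *)
have /choice[f fP] : forall i, exists f : B -> B,
    exists2 c, c != 0 & forall b, iota (f b) = c *: T i (iota b).
  by move=> i; have [_ [c [c0 _] /choice[f fE]]] := MT i; exists f, c.
exists n, f; split; [|split; [|split]].
- move=> i b; have [c c0 fE] := fP i; have [d Td] := Tscal i (iota b).
  by apply: (@iota_scalar_central (c * d)); rewrite fE Td scalerA.
- move=> i x y; have [c c0 fE] := fP i; apply: iota_inj.
  by rewrite iotaD !fE iotaD (linear_mapD (MT i).1) scalerDr.
- move=> i z b Zz; have [c c0 fE] := fP i; apply: iota_inj.
  rewrite fE !iota_central_mul // (linear_mapZ (MT i).1) fE !scalerA.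
  by rewrite [c * _]mulrC.
- move=> b fb0; apply: iota_inj; rewrite iota0; apply: Tinj => i.
  have [c c0 fE] := fP i; apply: (scalerI c0).
  by rewrite -fE fb0 iota0 scaler0.
Qed.

End Localization.

Theorem theorem2
  (F : fieldType) (B : lmodType F) (mulB : B -> B -> B) (B0 B1 : pred B) (oneB : B)
  (HB : is_superalgebra mulB B0 B1)
  (Hunit : is_unit_elt mulB oneB)
  (Halt : super_alternative mulB B0 B1)
  (Hnzd : forall z, in_even_center mulB B0 z -> z <> 0 ->
            forall b, (mulB z b = 0 \/ mulB b z = 0) -> b = 0)
  (k : fieldType) (A : lmodType k) (mulA : A -> A -> A) (A0 A1 : pred A)
  (iota : B -> A) (kappa : B -> k)
  (Hloc : is_localization mulB B0 B1 oneB mulA A0 A1 iota kappa)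
  (Hfd : finite_dim A)
  (Hcentral : central_super mulA A0 (iota oneB))
  (Hsimple : simple_super mulA A0 A1) :
  embeds_in_free_fg_module mulB (in_even_center mulB B0) \/
  exists (G : comAlgType k) (d : G -> G) (g : G),
    (3%N \in [pchar k]) /\ is_derivation d /\ d_simple d /\ iso_to_BG mulA A0 A1 d g.
Proof. by left; apply: localization_embeds HB Hunit Hloc Hcentral Hfd Hsimple. Qed.
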